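(* Any degree one vector field on $\mathbb{T}^2$ is a pseudo-type-1 vector field.
   Context: Fix a real number $a>1$ and let $\mathbb{T}^2=\{(x,y,z)\in\mathbb{R}^3:(x^2+y^2-a^2)^2+z^2-1=0\}$. A triple $\chi=(P,Q,R)$ with $P,Q,R\in\mathbb{R}[x,y,z]$ denotes the polynomial vector field $P\frac{\partial}{\partial x}+Q\frac{\partial}{\partial y}+R\frac{\partial}{\partial z}$ in $\mathbb{R}^3$, acting on polynomials as a derivation; its degree is $\max\{\deg P,\deg Q,\deg R\}$. It is called a vector field on $\mathbb{T}^2$ if $\chi F=KF$ for some $K\in\mathbb{R}[x,y,z]$, where $F=(x^2+y^2-a^2)^2+z^2-1$. It is called a pseudo-type-$n$ vector field if $P,Q$ are homogeneous polynomials of degree $n$ and $R=0$. *)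

(* Defs.v *)
From mathcomp Require Import all_boot all_order all_algebra.
From mathcomp Require Import reals.
From mathcomp Require Import mpoly.

Set Implicit Arguments.
Unset Strict Implicit.
Unset Printing Implicit Defensive.

Import GRing.Theory.
Local Open Scope ring_scope.

Definition ix : 'I_3 := @Ordinal 3 0 isT.
Definition iy : 'I_3 := @Ordinal 3 1 isT.
Definition iz : 'I_3 := @Ordinal 3 2 isT.

Record vfield (R : realType) := VField {
  compx : {mpoly R[3]};
  compy : {mpoly R[3]};
  compz : {mpoly R[3]}
}.

Definition vf_act (R : realType) (chi : vfield R) (f : {mpoly R[3]}) :
    {mpoly R[3]} :=
  compx chi * f^`M(ix) + compy chi * f^`M(iy) + compz chi * f^`M(iz).

(* [msize p] is 1 + the total degree of p, and 0 for p = 0; both the zero and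
   the nonzero constant vector fields get degree 0 here. *)
Definition vf_degree (R : realType) (chi : vfield R) : nat :=
  (maxn (msize (compx chi))
     (maxn (msize (compy chi)) (msize (compz chi)))).-1.

Definition torusF (R : realType) (a : R) : {mpoly R[3]} :=
  ('X_ix ^+ 2 + 'X_iy ^+ 2 - (a ^+ 2)%:MP) ^+ 2 + 'X_iz ^+ 2 - 1.

Definition on_torus (R : realType) (a : R) (chi : vfield R) : Prop :=
  exists K : {mpoly R[3]}, vf_act chi (torusF a) = K * torusF a.

(* As usual, the zero polynomial is [n.-homog] for every n. *)
Definition pseudo_type (R : realType) (n : nat) (chi : vfield R) : Prop :=
  [/\ compx chi \is n.-homog, compy chi \is n.-homog & compz chi = 0].

(* Main.v *)
(* An affine field P d/dx + Q d/dy + R d/dz tangent to the torus satisfies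
   2 (x^2 + y^2 - a^2) (x P + y Q) + z R = 0 at every real point of the torus, so
   the cofactor K plays no role.  At z^2 = 1, x^2 + y^2 = a^2 this reads R = 0,
   and the points (+-a, 0, 1), (0, +-a, 1), (a, 0, -1) force the affine
   polynomial R to vanish.  At (+-u, 0, 0) and (0, +-u, 0) with u^2 = a^2 + 1 one
   gets P = 0, resp. Q = 0, and averaging over the two signs kills the constant
   terms of P and Q. *)
Require Import Defs.
From mathcomp Require Import all_boot all_order all_algebra.
From mathcomp Require Import reals.
From mathcomp Require Import mpoly.
From mathcomp Require Import ring lra.

Set Implicit Arguments.
Unset Strict Implicit.
Unset Printing Implicit Defensive.

Import GRing.Theory.
Local Open Scope ring_scope.

Section Affine.
Variables (n : nat) (R : nzRingType).
Implicit Type p : {mpoly R[n]}.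

Lemma mpoly_affineE p : (msize p <= 2)%N ->
  p = (p@_0%MM)%:MP + \sum_(i < n) p@_U_(i) *: 'X_i.
Proof.
move=> hp; apply/mpolyP => m; rewrite mcoeffD mcoeffC raddf_sum /=.
have coefXU i : (p@_U_(i) *: 'X_i)@_m = p@_U_(i) * (U_(i)%MM == m)%:R.
  by rewrite mcoeffZ mcoeffX.
rewrite (eq_bigr _ (fun i _ => coefXU i)).
(* Coefficients are compared by the degree of [m]: 0, above 1 (both sides vanish), and exactly 1,
   where [m] is some [U_(i)]. *)
case: (ltngtP (mdeg m) 1) => [||/eqP/mdeg1P[i /eqP ->]].
- rewrite ltnS leqn0 mdeg_eq0 => /eqP ->; rewrite eqxx mulr1 big1 ?addr0 // => i _.
  by rewrite -mdeg_eq0 mdeg1 mulr0.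
- move=> m_gt1; rewrite memN_msupp_eq0 ?msize_mdeg_ge ?(leq_trans hp) //.
  have /negbTE -> : m != 0%MM by rewrite -mdeg_eq0; case: (mdeg m) m_gt1.
  rewrite mulr0 add0r big1 // => i _; have [Em|_] := eqVneq; last by rewrite mulr0.
  by rewrite -Em mdeg1 in m_gt1.
- rewrite -mdeg_eq0 mdeg1 mulr0 add0r (bigD1 i) //= eqxx mulr1 big1 ?addr0 //.
  by move=> j /negbTE ji; rewrite eq_mnm1 ji mulr0.
Qed.

(** Reduces homogeneity of [P] and [Q] to the vanishing of their constant terms. *)
Lemma affine_dhomog1 p : (msize p <= 2)%N -> p@_0%MM = 0 -> p \is 1.-homog.
Proof.
move=> hp p0; rewrite (mpoly_affineE hp) p0 mpolyC0 add0r.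
by apply: rpred_sum => i _; rewrite dhomogZ // dhomogX /= mdeg1.
Qed.

Lemma mderivXU (i j : 'I_n) : ('X_j : {mpoly R[n]})^`M(i) = (i == j)%:R.
Proof.
rewrite mderivX mnm1E eq_sym.
have [->|_] := eqVneq; last by rewrite scale0r.
by rewrite -{1}[U_(j)%MM]add0m addmK mpolyX0 scale1r.
Qed.

End Affine.

Section Torus.
Variable R : realType.
Implicit Types (a x y z : R) (chi : vfield R).

Definition point3 x y z (i : 'I_3) : R := nth 0 [:: x; y; z] i.

(** Evaluating the cofactor identity at a zero of [torusF a] kills its right side; the left side is
    then twice this expression. *)
Lemma on_torus_tangent a chi x y z : on_torus a chi ->
    (x ^+ 2 + y ^+ 2 - a ^+ 2) ^+ 2 + z ^+ 2 = 1 ->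
  2 * (x ^+ 2 + y ^+ 2 - a ^+ 2)
    * (x * (compx chi).@[point3 x y z] + y * (compy chi).@[point3 x y z])
  + z * (compz chi).@[point3 x y z] = 0.
Proof.
move=> [K /(congr1 (meval (point3 x y z)))] + hF.
have F0 : (torusF a).@[point3 x y z] = 0.
  rewrite /torusF !expr2 !(mevalB, mevalD, mevalC, meval1, mevalXU, mevalM).
  by rewrite /point3 /=; lra.
rewrite mevalM F0 mulr0 /vf_act /torusF !expr2.
rewrite !(mderivB, mderivD, mderivM, mderivC, mderivXU) /=.
rewrite !(mevalB, mevalD, mevalC, mevalM, mevalXU, rmorph0, rmorph1) /point3 /=.
by move=> h; lra.
Qed.

Lemma meval_affine3 (p : {mpoly R[3]}) x y z : (msize p <= 2)%N ->
  p.@[point3 x y z] = p@_0%MM + p@_U_(ix) * x + p@_U_(iy) * y + p@_U_(iz) * z.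
Proof.
move=> /mpoly_affineE {1}->.
rewrite mevalD mevalC raddf_sum /= !big_ord_recl big_ord0 !mevalZ !mevalXU /= addr0.
rewrite /point3 /= !addrA.
by do ![congr (_ + _)]; congr (p@_U_(_) * _); apply: val_inj.
Qed.

End Torus.

Theorem corollary4p3 (R : realType) (a : R) (ha : 1 < a) (chi : vfield R)
    (hchi : on_torus a chi) (hdeg : vf_degree chi = 1%N) :
  pseudo_type 1 chi.
Proof.
have /and3P[hP hQ hR] : [&& (msize (compx chi) <= 2)%N,
    (msize (compy chi) <= 2)%N & (msize (compz chi) <= 2)%N].
  by rewrite -!geq_max; move: hdeg; rewrite /vf_degree; case: maxn => [|[|[]]].
have tangent x y z := on_torus_tangent (x := x) (y := y) (z := z) hchi.
have R0 : compz chi = 0.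
  have a0 : a != 0 by apply/eqP; lra.
  have onR x y z : x ^+ 2 + y ^+ 2 = a ^+ 2 -> z ^+ 2 = 1 ->
      z * (compz chi).@[point3 x y z] = 0.
    move=> hxy hz; have := tangent x y z.
    by rewrite hxy subrr mulr0 mul0r add0r expr0n add0r; apply.
  (* Comparing [xp] with [xm] isolates the coefficient of x, and [yp] with [ym] that of y; then [xp]
     and [xz] give the sum and difference of the remaining two. *)
  have xp := onR a 0 1; have xm := onR (- a) 0 1; have xz := onR a 0 (-1).
  have yp := onR 0 a 1; have ym := onR 0 (- a) 1.
  rewrite !meval_affine3 // in xp xm xz yp ym.
  have {}xp := xp ltac:(ring) ltac:(ring).
  have {}xm := xm ltac:(ring) ltac:(ring).
  have {}xz := xz ltac:(ring) ltac:(ring).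
  have {}yp := yp ltac:(ring) ltac:(ring).
  have {}ym := ym ltac:(ring) ltac:(ring).
  have /eqP : (compz chi)@_U_(ix) * a = 0 by lra.
  rewrite mulf_eq0 (negbTE a0) orbF => /eqP cx.
  have /eqP : (compz chi)@_U_(iy) * a = 0 by lra.
  rewrite mulf_eq0 (negbTE a0) orbF => /eqP cy.
  rewrite cx cy in xp xz.
  have cz : (compz chi)@_U_(iz) = 0 by lra.
  have c0 : (compz chi)@_0%MM = 0 by lra.
  rewrite (mpoly_affineE hR) c0 mpolyC0 add0r big1 // => -[[|[|[|//]]] lti] _.
  - by rewrite (_ : Ordinal lti = ix) ?cx ?scale0r //; apply: val_inj.
  - by rewrite (_ : Ordinal lti = iy) ?cy ?scale0r //; apply: val_inj.
  - by rewrite (_ : Ordinal lti = iz) ?cz ?scale0r //; apply: val_inj.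
(* The radius of the outer circle of the torus in the plane z = 0: there [x ^+ 2 + y ^+ 2 - a ^+ 2]
   is 1, so tangency becomes xP + yQ = 0. *)
pose u := Num.sqrt (a ^+ 2 + 1).
have u2 : u ^+ 2 = a ^+ 2 + 1 by rewrite Num.Theory.sqr_sqrtr //; nra.
have u0 : u != 0 by apply/eqP => u0; move: u2; rewrite u0; nra.
have onPQ x y : x ^+ 2 + y ^+ 2 = u ^+ 2 ->
    x * (compx chi).@[point3 x y 0] + y * (compy chi).@[point3 x y 0] = 0.
  move=> hxy; have := tangent x y 0; rewrite hxy u2.
  by move=> /(_ ltac:(ring)) h; lra.
have cancel_u (c : R) : u * c = 0 -> c = 0.
  by move=> /eqP; rewrite mulf_eq0 (negbTE u0) => /eqP.
(* With the factor [u] kept, the goal is half the difference of the relations at two opposite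
   points, hence linear in their monomials. *)
split=> //; apply: affine_dhomog1 => //; apply: cancel_u.
- have := onPQ u 0; have := onPQ (- u) 0.
  rewrite !meval_affine3 //.
  move=> /(_ ltac:(ring)) h1 /(_ ltac:(ring)) h2.
  lra.
- have := onPQ 0 u; have := onPQ 0 (- u).
  rewrite !meval_affine3 //.
  move=> /(_ ltac:(ring)) h1 /(_ ltac:(ring)) h2.
  lra.
Qed.
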